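(* For any 4-way deterministic aperiodic tile set $T$, the NPC square complex $W(T)$ is not virtually special, and the 2-dimensional event domain $(\widetilde W(T)_{\widetilde v},\prec_{\widetilde o^*})$ does not admit a regular nice labeling.
   Context: A Wang tile is a unit square with colored edges; a tile set $T$ is a finite set of tiles, horizontal and vertical edges using disjoint color sets. A tiling $f:\mathbb Z^2\to T$ is valid if adjacent tiles agree on common edges (no rotations); it is periodic with period $(a,b)\ne(0,0)$ if $f(x,y)=f(x+a,y+b)$ for all $(x,y)$. $T$ is aperiodic if it admits a valid tiling but no periodic valid tiling. $T$ is 4-way deterministic if no two distinct tiles agree on (top, left), nor on (top, right), nor on (bottom, left), nor on (bottom, right) colors. $\mathbf X(T)$: take the tiles as squares, horizontal edges oriented left to right, vertical edges bottom to top, identify all vertices into one and glue edges of equal color respecting orientation. $W(T)$: take the first barycentric subdivision of $\mathbf X(T)$ (edge midpoints and square centers added; half-edges keep orientation; the four new edges of each square oriented left to right and bottom to top) and attach at the midpoint of each edge of color $\alpha$ a directed path (tip) of length $r(\alpha)$, oriented away from the midpoint, for a fixed injection $r$ from colors to positive integers; call the orientation $o^*$. $\widetilde W(T)$ is the universal cover with lifted orientation $\widetilde o^*$, $\widetilde v$ a vertex lying over the vertex of $\mathbf X(T)$, and $\widetilde W(T)_{\widetilde v}$ the set of vertices reachable from $\widetilde v$ by directed paths, ordered by reachability. A finite NPC complex is virtually special if it has a finite cover which is special (hyperplanes two-sided, not self-intersecting, not directly self-osculating, and no two hyperplanes both intersecting and osculating). A nice labeling of a domain is a labeling of the directed edges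 of its Hasse diagram by a finite alphabet such that edges out of a common vertex get distinct labels and opposite edges of each square get equal labels; it is regular if there are finitely many label-preserving isomorphism types of labeled principal filters. *)

(* Defs.v *)
From mathcomp Require Import all_boot all_algebra.
From Stdlib Require Import Relations.Relation_Operators List.

Set Implicit Arguments.
Unset Strict Implicit.
Unset Printing Implicit Defensive.

Import GRing.Theory.

(* Horizontal colours HC (top/bottom edges) and vertical colours VC
   (left/right edges) are two separate types, hence disjoint. *)
Record tileset := TileSet {
  HC : finType;
  VC : finType;
  tile : finType;
  ttop : tile -> HC;
  tbot : tile -> HC;
  tlft : tile -> VC;
  trgt : tile -> VC }.

Definition tileset_wf (T : tileset) : Prop :=
  injective (fun t : tile T => (ttop t, tbot t, tlft t, trgt t)) /\
  (forall c : HC T, exists t, ttop t = c \/ tbot t = c) /\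
  (forall c : VC T, exists t, tlft t = c \/ trgt t = c).

Definition valid_tiling (T : tileset) (f : int -> int -> tile T) : Prop :=
  forall x y : int,
    trgt (f x y) = tlft (f (x + 1)%R y) /\ ttop (f x y) = tbot (f x (y + 1)%R).

Definition periodic_with (T : tileset) (f : int -> int -> tile T) (a b : int)
  : Prop :=
  (a, b) <> (0%R, 0%R) /\ forall x y : int, f x y = f (x + a)%R (y + b)%R.

Definition aperiodic (T : tileset) : Prop :=
  (exists f : int -> int -> tile T, valid_tiling f) /\
  ~ (exists (f : int -> int -> tile T) (a b : int), valid_tiling f /\ periodic_with f a b).

Definition four_way_det (T : tileset) : Prop :=
  (forall t1 t2 : tile T, ttop t1 = ttop t2 -> tlft t1 = tlft t2 -> t1 = t2) /\
  (forall t1 t2 : tile T, ttop t1 = ttop t2 -> trgt t1 = trgt t2 -> t1 = t2) /\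
  (forall t1 t2 : tile T, tbot t1 = tbot t2 -> tlft t1 = tlft t2 -> t1 = t2) /\
  (forall t1 t2 : tile T, tbot t1 = tbot t2 -> trgt t1 = trgt t2 -> t1 = t2).

(* Every edge carries an orientation (src -> tgt).  A square has four
   sides, side i traversed forward (true) or backward (false), forming a
   closed cycle (see [sc_wf]). *)
Record sqcx := SqCx {
  Vx : Type;
  Ex : Type;
  Sx : Type;
  src : Ex -> Vx;
  tgt : Ex -> Vx;
  bd : Sx -> 'I_4 -> Ex * bool }.

Section SqComplexNotions.
Variable X : sqcx.

Definition ostart (eb : Ex X * bool) : Vx X :=
  if eb.2 then src eb.1 else tgt eb.1.
Definition oend (eb : Ex X * bool) : Vx X :=
  if eb.2 then tgt eb.1 else src eb.1.

Definition side (s : Sx X) (k : nat) : Ex X * bool := bd s (inord (k %% 4)).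
Definition corner (s : Sx X) (k : nat) : Vx X := ostart (side s k).

Definition sc_wf : Prop :=
  forall s k, oend (side s k) = ostart (side s k.+1).

Fixpoint path_from (v : Vx X) (p : list (Ex X * bool)) : Prop :=
  match p with
  | nil => True
  | eb :: q => ostart eb = v /\ path_from (oend eb) q
  end.
Fixpoint path_end (v : Vx X) (p : list (Ex X * bool)) : Vx X :=
  match p with
  | nil => v
  | eb :: q => path_end (oend eb) q
  end.

Definition rev_path (p : list (Ex X * bool)) : list (Ex X * bool) :=
  List.rev (List.map (fun eb => (eb.1, ~~ eb.2)) p).

Definition sq_cycle (s : Sx X) (k : nat) : list (Ex X * bool) :=
  [:: side s k; side s k.+1; side s k.+2; side s k.+3].

Inductive hstep : list (Ex X * bool) -> list (Ex X * bool) -> Prop :=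
| hs_back p q e b : hstep (p ++ (e, b) :: (e, ~~ b) :: q) (p ++ q)
| hs_sq p q s k : hstep (p ++ sq_cycle s k ++ q) (p ++ q)
| hs_sqr p q s k : hstep (p ++ rev_path (sq_cycle s k) ++ q) (p ++ q).

Definition homotopic := clos_refl_sym_trans _ hstep.

Definition connected : Prop :=
  forall u w : Vx X, exists p, path_from u p /\ path_end u p = w.

Definition simply_connected : Prop :=
  connected /\
  forall v p, path_from v p -> path_end v p = v -> homotopic p nil.

Definition finite_type (A : Type) : Prop :=
  exists l : list A, forall a, List.In a l.

Definition finite_cx : Prop :=
  finite_type (Vx X) /\ finite_type (Ex X) /\ finite_type (Sx X).

Definition opposite (e e' : Ex X) : Prop :=
  exists s k, (side s k).1 = e /\ (side s k.+2).1 = e'.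
Definition hyp_eq := clos_refl_sym_trans _ opposite.

Definition in_common_square (e1 e2 : Ex X) : Prop :=
  exists s k, ((side s k).1 = e1 /\ (side s k.+1).1 = e2) \/
              ((side s k).1 = e2 /\ (side s k.+1).1 = e1).

(* a choice d of orientations of the edges dual to hyperplanes
   (d e = true: same as the orientation of e) such that opposite sides of
   every square are parallel.  Existence = all hyperplanes two-sided. *)
Definition consistent_dual (d : Ex X -> bool) : Prop :=
  forall s k,
    (d (side s k).1 == (side s k).2) = ~~ (d (side s k.+2).1 == (side s k.+2).2).

Definition dstart (d : Ex X -> bool) (e : Ex X) : Vx X :=
  if d e then src e else tgt e.
Definition dend (d : Ex X -> bool) (e : Ex X) : Vx X :=
  if d e then tgt e else src e.

Definition self_intersects : Prop :=
  exists s k, hyp_eq (side s k).1 (side s k.+1).1.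

Definition directly_self_osculates (d : Ex X -> bool) : Prop :=
  exists e1 e2, e1 <> e2 /\ hyp_eq e1 e2 /\
    (dstart d e1 = dstart d e2 \/ dend d e1 = dend d e2) /\
    ~ in_common_square e1 e2.

Definition share_vertex (e1 e2 : Ex X) : Prop :=
  src e1 = src e2 \/ src e1 = tgt e2 \/ tgt e1 = src e2 \/ tgt e1 = tgt e2.

Definition interosculate (e1 e2 : Ex X) : Prop :=
  ~ hyp_eq e1 e2 /\
  (exists s k, hyp_eq (side s k).1 e1 /\ hyp_eq (side s k.+1).1 e2) /\
  (exists f1 f2, hyp_eq f1 e1 /\ hyp_eq f2 e2 /\ share_vertex f1 f2 /\
                 ~ in_common_square f1 f2).

Definition special : Prop :=
  exists d : Ex X -> bool,
    consistent_dual d /\ ~ self_intersects /\ ~ directly_self_osculates d /\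
    ~ (exists e1 e2, interosculate e1 e2).

Definition dreach (u w : Vx X) : Prop :=
  exists p, path_from u p /\ List.Forall (fun eb => eb.2 = true) p /\
            path_end u p = w.

End SqComplexNotions.

Record cxmap (X Y : sqcx) := CxMap {
  mV : Vx X -> Vx Y;
  mE : Ex X -> Ex Y;
  mS : Sx X -> Sx Y }.

Definition is_covering (X Y : sqcx) (f : cxmap X Y) : Prop :=
  (forall e, mV f (src e) = src (mE f e)) /\
  (forall e, mV f (tgt e) = tgt (mE f e)) /\
  (forall s i, bd (mS f s) i = (mE f (bd s i).1, (bd s i).2)) /\
  (forall y, exists x, mV f x = y) /\
  (forall v e1 e2 b, ostart (e1, b) = v -> ostart (e2, b) = v ->
       mE f e1 = mE f e2 -> e1 = e2) /\
  (forall v e' b, ostart (e', b) = mV f v ->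
       exists e, ostart (e, b) = v /\ mE f e = e') /\
  (forall v s1 s2 k, corner s1 k = v -> corner s2 k = v ->
       mS f s1 = mS f s2 -> s1 = s2) /\
  (forall v s' k, corner s' k = mV f v ->
       exists s, corner s k = v /\ mS f s = s').

Definition virtually_special (X : sqcx) : Prop :=
  exists (Y : sqcx) (f : cxmap Y X),
    sc_wf Y /\ finite_cx Y /\ is_covering f /\ special Y.

Section Labelings.
Variables (D : Type) (le : D -> D -> Prop).

Definition plt (x y : D) : Prop := le x y /\ x <> y.
Definition hcov (x y : D) : Prop :=
  plt x y /\ ~ (exists z, plt x z /\ plt z y).

Definition nice_labeling (A : Type) (lam : D -> D -> A) : Prop :=
  (forall x y1 y2, hcov x y1 -> hcov x y2 -> y1 <> y2 -> lam x y1 <> lam x y2) /\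
  (forall x y1 y2 z, hcov x y1 -> hcov x y2 -> hcov y1 z -> hcov y2 z ->
       y1 <> y2 -> lam x y1 = lam y2 z /\ lam x y2 = lam y1 z).

Definition filters_iso (A : Type) (lam : D -> D -> A) (x y : D) : Prop :=
  exists phi psi : D -> D,
    (forall a, le x a -> le y (phi a) /\ psi (phi a) = a) /\
    (forall b, le y b -> le x (psi b) /\ phi (psi b) = b) /\
    (forall a a', le x a -> le x a' -> (le a a' <-> le (phi a) (phi a'))) /\
    (forall a a', le x a -> le x a' -> hcov a a' -> lam (phi a) (phi a') = lam a a').

Definition regular_labeling (A : Type) (lam : D -> D -> A) : Prop :=
  exists l : list D, forall x, exists y, List.In y l /\ filters_iso lam x y.

Definition admits_regular_nice_labeling : Prop :=
  exists (n : nat) (lam : D -> D -> 'I_n),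
    nice_labeling lam /\ regular_labeling lam.

End Labelings.

Definition evdom (X : sqcx) (v : Vx X) : Type := {u : Vx X | dreach v u}.
Definition evle (X : sqcx) (v : Vx X) (x y : evdom v) : Prop :=
  dreach (sval x) (sval y).

Definition color (T : tileset) : Type := (HC T + VC T)%type.

Section WT.
Variables (T : tileset) (r : color T -> nat).

Definition cb (t : tile T) : color T := inl (tbot t).
Definition ct (t : tile T) : color T := inl (ttop t).
Definition cl (t : tile T) : color T := inr (tlft t).
Definition cr (t : tile T) : color T := inr (trgt t).

Inductive WV : Type :=
| Star                                  (* the vertex of X(T) *)
| Mid (c : color T)                     (* midpoint of edge c *)
| Cen (t : tile T)                      (* centre of square t *)
| TipV (c : color T) (i : 'I_(r c)).    (* (i+1)-th vertex of the tip at c *)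

Inductive WE : Type :=
| Half (c : color T) (second : bool)
| InL (t : tile T)
| InR (t : tile T)
| InB (t : tile T)
| InT (t : tile T)
| TipE (c : color T) (i : 'I_(r c)).

(* squares: (tile, quadrant) with quadrant 0 = bottom-left, 1 = bottom-right,
   2 = top-left, 3 = top-right *)
Definition WS : Type := (tile T * 'I_4)%type.

Definition tip_prev (c : color T) (i : 'I_(r c)) : WV :=
  match i with
  | Ordinal 0 _ => Mid c
  | Ordinal (S j) H => TipV (Ordinal (ltnW H))
  end.

Definition Wsrc (e : WE) : WV :=
  match e with
  | Half c false => Star
  | Half c true => Mid c
  | InL t => Mid (cl t)
  | InR t => Cen t
  | InB t => Mid (cb t)
  | InT t => Cen t
  | TipE c i => tip_prev i
  end.

Definition Wtgt (e : WE) : WV :=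
  match e with
  | Half c false => Mid c
  | Half c true => Star
  | InL t => Cen t
  | InR t => Mid (cr t)
  | InB t => Cen t
  | InT t => Mid (ct t)
  | TipE c i => TipV i
  end.

Definition Wbd (s : WS) (i : 'I_4) : WE * bool :=
  let t := s.1 in
  match nat_of_ord s.2, nat_of_ord i with
  (* bottom-left:  Star -> Mid b -> Cen -> Mid l -> Star *)
  | 0, 0 => (Half (cb t) false, true)
  | 0, 1 => (InB t, true)
  | 0, 2 => (InL t, false)
  | 0, _ => (Half (cl t) false, false)
  (* bottom-right: Mid b -> Star -> Mid r -> Cen -> Mid b *)
  | 1, 0 => (Half (cb t) true, true)
  | 1, 1 => (Half (cr t) false, true)
  | 1, 2 => (InR t, false)
  | 1, _ => (InB t, false)
  (* top-left: Mid l -> Cen -> Mid t -> Star -> Mid l *)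
  | 2, 0 => (InL t, true)
  | 2, 1 => (InT t, true)
  | 2, 2 => (Half (ct t) false, false)
  | 2, _ => (Half (cl t) true, false)
  (* top-right: Cen -> Mid r -> Star -> Mid t -> Cen *)
  | _, 0 => (InR t, true)
  | _, 1 => (Half (cr t) true, true)
  | _, 2 => (Half (ct t) true, false)
  | _, _ => (InT t, false)
  end.

(* W(T) with its orientation o* (the src/tgt of the edges) *)
Definition WT : sqcx := SqCx Wsrc Wtgt Wbd.

End WT.

(* Main.v *)
(** In any cover of W(T), a quadrant of a valid tiling lifts.  Label the edges
    of the cover by hyperplanes (finite special cover) or by the nice labeling
    (universal cover).  Labels are constant along the strips of the lifted
    quadrant, and the out-edges of a vertex have distinct labels, so a vertex
    (or the isomorphism type of its principal filter) together with a label
    determines its successor.  As there are finitely many vertices, resp.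
    types, two points of the left border of the quadrant agree, hence so do
    their rows; two points of such a row agree, hence so do their columns.  The
    rectangle they span tiles a torus, contradicting aperiodicity.  For filters,
    the color of an edge is recovered from the length of its tip.  In a simply
    connected complex whose orientation is parallel on every square, closed
    paths have signed length 0, so the covers of the event domain are exactly
    the edges. *)
Require Import Defs.
From mathcomp Require Import all_boot all_algebra.
From mathcomp Require Import zify.
From Stdlib Require Import Classical ClassicalEpsilon ProofIrrelevance.
From Stdlib Require Import Relation_Operators.

Set Implicit Arguments.
Unset Strict Implicit.
Unset Printing Implicit Defensive.

Import GRing.Theory.

(** * Periodic tilings from finitely many states *)

(** The counting is done on positions in [l], because [S] carries no decidable equality: one more
    index than positions forces a collision. *)
Lemma pigeonhole_In (S : Type) (l : list S) (R : nat -> S -> Prop) :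
  (forall i, exists y, List.In y l /\ R i y) ->
  exists i j y, i < j /\ R i y /\ R j y.
Proof.
move=> H; pose n := List.length l.
have HR (i : 'I_n.+1) : exists k : 'I_n,
    exists y, List.nth_error l k = Some y /\ R i y.
  have [y [y_l Ry]] := H i; have [k Hk] := List.In_nth_error _ _ y_l.
  have lt_kn : k < n by apply/ltP/List.nth_error_Some; rewrite Hk.
  by exists (Ordinal lt_kn), y.
have [g Hg] := fin_all_exists HR.
have /injectivePn [i [j neq_ij eq_g]] : ~~ injectiveb g.
  by apply/negP=> /injectiveP /leq_card; rewrite !card_ord ltnn.
have [y [Ey Ry]] := Hg i; have [z [Ez Rz]] := Hg j.
have Eyz : z = y by move: Ez; rewrite -eq_g Ey => -[].
rewrite {z Ez}Eyz in Rz.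
case: (ltngtP i j) => [lt_ij|lt_ji|/val_inj Eij].
- by exists i, j, y.
- by exists j, i, y.
- by rewrite Eij eqxx in neq_ij.
Qed.

(** Separates the interior of the fundamental rectangle from its seam, where the successor wraps to
    0. *)
Lemma modz_succ (x : int) (p : nat) : 0 < p ->
  exists2 k : nat, k < p &
    (x %% p)%Z = k /\ ((x + 1)%R %% p)%Z = (if k.+1 == p then 0%N else k.+1).
Proof.
move=> p_gt0.
have p_neq0 : Posz p != 0%R by lia.
have := modz_ge0 x p_neq0; have := ltz_pmod x (d := Posz p) ltac:(lia).
case E: (x %% p)%Z => [k|k] // lt_kp _; exists k; first by lia.
split=> //; rewrite {1}(divz_eq x p) E -addrA modzMDl.
case: eqP => Ek.
  by rewrite (_ : (Posz k + 1)%R = p) ?modzz //; lia.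
by rewrite modz_small; lia.
Qed.

(* Equal states on the left border at heights j1 < j2 make the whole rows j1
   and j2 agree; equal states in columns i1 < i2 of row j1 then make these
   columns agree above j1, so the rectangle between them tiles a torus. *)
Lemma periodic_of_finite_states (T : tileset) (f : int -> int -> tile T)
    (S : Type) (sim : S -> S -> Prop) (X : nat -> nat -> S) (l : list S) :
  valid_tiling f ->
  (forall x y, sim x y -> sim y x) ->
  (forall x y z, sim x y -> sim y z -> sim x z) ->
  (forall i j, exists y, List.In y l /\ sim (X i j) y) ->
  (forall i j j', sim (X i j) (X i j') ->
     tbot (f i j) = tbot (f i j') /\ sim (X i.+1 j) (X i.+1 j')) ->
  (forall i i' j, sim (X i j) (X i' j) ->
     tlft (f i j) = tlft (f i' j) /\ sim (X i j.+1) (X i' j.+1)) ->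
  exists (g : int -> int -> tile T) (a b : int),
    valid_tiling g /\ periodic_with g a b.
Proof.
move=> f_valid sim_sym sim_trans fin row col.
have [j1 [j2 [y [lt_j [s1 s2]]]]] := pigeonhole_In (fin 0%N).
have rows i : sim (X i j1) (X i j2).
  elim: i => [|i IHi]; first exact: sim_trans s1 (sim_sym _ _ s2).
  exact: (row _ _ _ IHi).2.
have [i1 [i2 [z [lt_i [t1 t2]]]]] := pigeonhole_In (fin^~ j1).
have cols k : sim (X i1 (j1 + k)) (X i2 (j1 + k)).
  elim: k => [|k IHk]; first by rewrite addn0; exact: sim_trans t1 (sim_sym _ _ t2).
  by rewrite addnS; exact: (col _ _ _ IHk).2.
pose p := (i2 - i1)%N; pose q := (j2 - j1)%N.
have p_gt0 : 0 < p by rewrite subn_gt0.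
have q_gt0 : 0 < q by rewrite subn_gt0.
exists (fun x y => f (Posz i1 + (x %% p)%Z)%R (Posz j1 + (y %% q)%Z)%R), p, 0%R.
split; last first.
  split; first by case=> E; rewrite E in p_gt0.
  by move=> x w; rewrite addr0 modzDr.
move=> x w; have [k lt_k [Ek Ek1]] := modz_succ x p_gt0.
have [m lt_m [Em Em1]] := modz_succ w q_gt0.
rewrite Ek Em Ek1 Em1 -!PoszD; split.
  have [-> _] := f_valid (i1 + k)%N (j1 + m)%N.
  case: eqP => Ep; last by congr (tlft (f _ _)); lia.
  rewrite (_ : (Posz (i1 + k)%N + 1)%R = i2); last by rewrite /p in Ep; lia.
  by rewrite addn0 (col _ _ _ (cols m)).1.
have [_ ->] := f_valid (i1 + k)%N (j1 + m)%N.
case: eqP => Eq; last by congr (tbot (f _ _)); lia.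
rewrite (_ : (Posz (j1 + m)%N + 1)%R = j2); last by rewrite /q in Eq; lia.
by rewrite addn0 (row _ _ _ (rows _)).1.
Qed.

(** * Covers of W(T) *)

(** Unlike the [inord] inside [side], this index reduces by computation, so [Wbd] can be evaluated
    at it. *)
Definition ord4 (k : nat) : 'I_4 := Ordinal (ltn_pmod k (isT : 0 < 4)).

Lemma side_ord4 (X : sqcx) (s : Sx X) k : side s k = bd s (ord4 k).
Proof. by congr (bd s); apply: val_inj; rewrite /= inordK ?ltn_pmod. Qed.

Lemma side_mod4 (X : sqcx) (s : Sx X) k : side s k = side s (k %% 4).
Proof. by rewrite /side modn_mod. Qed.

(** Bundles what both labelings need: [opposite] for hyperplanes, and for nice labelings a directed
    square in which [e] and [a] leave one vertex towards two different ones. *)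
Definition parallel (X : sqcx) (e e' : Ex X) : Prop :=
  exists a b : Ex X,
    [/\ src a = src e, src b = tgt e, src e' = tgt a, tgt e' = tgt b
      & tgt e <> tgt a] /\ opposite e e'.

Lemma opposite_sym (X : sqcx) (e e' : Ex X) : opposite e e' -> opposite e' e.
Proof.
by case=> s [k [Ee Ee']]; exists s, k.+2.
Qed.

Section Covering.
Variables (T : tileset) (r : color T -> nat) (Z : sqcx) (p : cxmap Z (WT r)).
Hypothesis p_cov : is_covering p.

Lemma cov_src e : mV p (src e) = Wsrc (mE p e).
Proof. by case: p_cov. Qed.

Lemma cov_tgt e : mV p (tgt e) = Wtgt (mE p e).
Proof. by case: p_cov => _ []. Qed.

Lemma cov_bd s i : Wbd r (mS p s) i = (mE p (bd s i).1, (bd s i).2).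
Proof. by case: p_cov => _ [_ [H _]]; exact: H. Qed.

Lemma cov_edge_inj e1 e2 : src e1 = src e2 -> mE p e1 = mE p e2 -> e1 = e2.
Proof.
case: p_cov => _ [_ [_ [_ [H _]]]] Esrc; apply: (H (src e2) e1 e2 true) => //.
Qed.

Lemma cov_edge_lift x e' : Wsrc e' = mV p x ->
  exists e, src e = x /\ mE p e = e'.
Proof.
case: p_cov => _ [_ [_ [_ [_ [H _]]]]] Esrc.
by have [e [Ee He]] := H x e' true Esrc; exists e.
Qed.

Lemma cov_sq_lift x (s' : Sx (WT r)) : corner s' 0 = mV p x ->
  exists s, corner s 0 = x /\ mS p s = s'.
Proof.
case: p_cov => _ [_ [_ [_ [_ [_ [_ H]]]]]] Ecor.
by have [s [Es Hs]] := H x s' 0 Ecor; exists s.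
Qed.

Hypothesis Z_wf : sc_wf Z.

(** [Wbd] starts each quadrant at its source corner, so the lift at that corner is a directed square
    from [x], reached by [a] then [b] or by [d] then [c]. *)
Lemma lift_square (t : tile T) (q : 'I_4) x :
  mV p x = Wsrc (Wbd r (t, q) (ord4 0)).1 ->
  exists a b c d : Ex Z,
    [/\ src a = x, src d = x, src b = tgt a, src c = tgt d & tgt b = tgt c] /\
    [/\ mE p a = (Wbd r (t, q) (ord4 0)).1, mE p b = (Wbd r (t, q) (ord4 1)).1,
        mE p c = (Wbd r (t, q) (ord4 2)).1 & mE p d = (Wbd r (t, q) (ord4 3)).1] /\
    parallel a c /\ parallel d b.
Proof.
move=> Ex0.
have [|s [Es Hs]] := @cov_sq_lift x (t, q).
  by rewrite Ex0 /corner side_ord4 /=; case: q {Ex0} => -[|[|[|[|//]]]] ?.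
have B i := cov_bd s i; have W := Z_wf s.
move: Es; rewrite /corner; move: (W 0) (W 1) (W 2) (W 3).
rewrite [side s 4]side_mod4 -/(side s 0) !side_ord4.
move: (B (ord4 0)) (B (ord4 1)) (B (ord4 2)) (B (ord4 3)); rewrite Hs.
have O02 : opposite (bd s (ord4 0)).1 (bd s (ord4 2)).1.
  by exists s, 0; rewrite !side_ord4.
have O31 : opposite (bd s (ord4 3)).1 (bd s (ord4 1)).1.
  by apply: opposite_sym; exists s, 1; rewrite !side_ord4.
case: (bd s (ord4 0)) O02 => a fa /= O02; case: (bd s (ord4 1)) O31 => b fb /= O31.
case: (bd s (ord4 2)) O02 => c fc /= O02; case: (bd s (ord4 3)) O31 => d fd /= O31.
rewrite -/(ord4 0) -/(ord4 1) -/(ord4 2) -/(ord4 3).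
move=> B0 B1 B2 B3.
(* All four quadrants have the same traversal pattern. The ends of sides 0 and 3 differ already in
   W(T), hence also in the cover. *)
have [-> -> -> -> neq] : [/\ fa = true, fb = true, fc = false, fd = false &
    Wtgt (Wbd r (t, q) (ord4 0)).1 <> Wtgt (Wbd r (t, q) (ord4 3)).1].
  move: B0 B1 B2 B3; case: q {Ex0 Hs} => -[|[|[|[|//]]]] ? /= [_ <-] [_ <-] [_ <-] [_ <-];
    by split.
rewrite /ostart /oend /= => ab bc cd da ax.
rewrite B0 B1 B2 B3 /=; exists a, b, c, d; split; first by split=> //; congruence.
split=> //.
have neq' : tgt a <> tgt d.
  by move=> /(congr1 (mV p)); rewrite !cov_tgt; move: neq; rewrite B0 B3.
by split; [exists d, b | exists a, c]; split=> //; split; congruence.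
Qed.

(** The quadrants are lifted one after another, each at its source corner, and fit together along
    the four inner edges by uniqueness of edge lifts. *)
Lemma lift_tile (t : tile T) x : mV p x = Star r ->
  exists b1 b2 l1 l2 t1 t2 r1 r2 : Ex Z,
    [/\ src b1 = x, src b2 = tgt b1, src r1 = tgt b2, src r2 = tgt r1
      & tgt r2 = tgt t2] /\
    [/\ src l1 = x, src l2 = tgt l1, src t1 = tgt l2 & src t2 = tgt t1] /\
    [/\ mE p b1 = Half r (cb t) false, mE p b2 = Half r (cb t) true,
        mE p l1 = Half r (cl t) false & mE p l2 = Half r (cl t) true] /\
    [/\ mE p t1 = Half r (ct t) false, mE p t2 = Half r (ct t) true,
        mE p r1 = Half r (cr t) false & mE p r2 = Half r (cr t) true] /\
    [/\ exists2 e, parallel b1 e & parallel e t1,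
        exists2 e, parallel b2 e & parallel e t2,
        exists2 e, parallel l1 e & parallel e r1 &
        exists2 e, parallel l2 e & parallel e r2].
Proof.
move=> xS.
have [a0 [b0 [c0 [d0 [[A0 A1 A2 A3 A4] [[M0 M1 M2 M3] [P0 Q0]]]]]]] :=
  @lift_square t (ord4 0) x xS.
have [|a1 [b1 [c1 [d1 [[B0 B1 B2 B3 B4] [[N0 N1 N2 N3] [P1 Q1]]]]]]] :=
  @lift_square t (ord4 1) (tgt a0); first by rewrite cov_tgt M0.
have [|a2 [b2 [c2 [d2 [[C0 C1 C2 C3 C4] [[K0 K1 K2 K3] [P2 Q2]]]]]]] :=
  @lift_square t (ord4 2) (tgt d0); first by rewrite cov_tgt M3.
have [|a3 [b3 [c3 [d3 [[D0 D1 D2 D3 D4] [[L0 L1 L2 L3] [P3 Q3]]]]]]] :=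
  @lift_square t (ord4 3) (tgt b0); first by rewrite cov_tgt M1.
(* The shared edges are, in order, the lifts of [InB], [InL], [InR] and [InT]. *)
have E1 : d1 = b0 by apply: cov_edge_inj; [congruence | rewrite N3 M1].
have E2 : a2 = c0 by apply: cov_edge_inj; [congruence | rewrite K0 M2].
have E3 : a3 = c1 by apply: cov_edge_inj; [congruence | rewrite L0 N2].
have E4 : d3 = b2 by apply: cov_edge_inj; [congruence | rewrite L3 K1].
subst d1 a2 a3 d3.
exists a0, a1, d0, d2, c2, c3, b1, b3; do !split=> //; try congruence.
- by exists c0.
- by exists c1.
- by exists b0.
- by exists b2.
Qed.

Lemma lift_color_path (x : {x : Vx Z | mV p x = Star r}) (c : color T) :
  exists ee : Ex Z * Ex Z,
    [/\ src ee.1 = sval x, mE p ee.1 = Half r c false, src ee.2 = tgt ee.1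
      & mE p ee.2 = Half r c true].
Proof.
case: x => x xS /=.
have [|e1 [S1 M1]] := @cov_edge_lift x (Half r c false); first by rewrite xS.
have [|e2 [S2 M2]] := @cov_edge_lift (tgt e1) (Half r c true).
  by rewrite cov_tgt M1.
by exists (e1, e2).
Qed.

(** Edges of given color lift uniquely at each vertex over [Star]; each lifted tile closes up, so
    the grid point reached does not depend on the monotone path taken. *)
Lemma lift_quadrant (f : int -> int -> tile T) (v : Vx Z) :
  valid_tiling f -> mV p v = Star r ->
  exists (X : nat -> nat -> Vx Z) (h1 h2 v1 v2 : nat -> nat -> Ex Z),
    X 0 0 = v /\ forall i j,
    [/\ src (h1 i j) = X i j, src (h2 i j) = tgt (h1 i j),
        tgt (h2 i j) = X i.+1 j & mE p (h1 i j) = Half r (cb (f i j)) false] /\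
    [/\ src (v1 i j) = X i j, src (v2 i j) = tgt (v1 i j),
        tgt (v2 i j) = X i j.+1 & mE p (v1 i j) = Half r (cl (f i j)) false] /\
    [/\ exists2 e, parallel (h1 i j) e & parallel e (h1 i j.+1),
        exists2 e, parallel (h2 i j) e & parallel e (h2 i j.+1),
        exists2 e, parallel (v1 i j) e & parallel e (v1 i.+1 j) &
        exists2 e, parallel (v2 i j) e & parallel e (v2 i.+1 j)].
Proof.
move=> f_valid vS.
pose S := {x : Vx Z | mV p x = Star r}.
pose h (x : S) c := sval (constructive_indefinite_description _ (lift_color_path x c)).
have hP (x : S) c : [/\ src (h x c).1 = sval x, mE p (h x c).1 = Half r c false,
    src (h x c).2 = tgt (h x c).1 & mE p (h x c).2 = Half r c true].
  exact: svalP (constructive_indefinite_description _ (lift_color_path x c)).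
have h_uniq (x : S) c e1 e2 : src e1 = sval x -> mE p e1 = Half r c false ->
    src e2 = tgt e1 -> mE p e2 = Half r c true -> h x c = (e1, e2).
  move=> s1 m1 s2 m2; have [s1' m1' s2' m2'] := hP x c.
  have E1 : (h x c).1 = e1 by apply: cov_edge_inj; congruence.
  have E2 : (h x c).2 = e2 by apply: cov_edge_inj; congruence.
  by rewrite -E1 -E2; case: (h x c).
have nxtS x c : mV p (tgt (h x c).2) = Star r.
  by have [_ _ _ E] := hP x c; rewrite cov_tgt E.
pose nxt (x : S) c : S := exist _ _ (nxtS x c).
have S_inj (x y : S) : sval x = sval y -> x = y.
  by case: x y => x px [y py] /= E; subst y; rewrite (proof_irrelevance _ px py).
have tileP (x : S) t :
    nxt (nxt x (cb t)) (cr t) = nxt (nxt x (cl t)) (ct t) /\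
    [/\ exists2 e, parallel (h x (cb t)).1 e & parallel e (h (nxt x (cl t)) (ct t)).1,
        exists2 e, parallel (h x (cb t)).2 e & parallel e (h (nxt x (cl t)) (ct t)).2,
        exists2 e, parallel (h x (cl t)).1 e & parallel e (h (nxt x (cb t)) (cr t)).1 &
        exists2 e, parallel (h x (cl t)).2 e & parallel e (h (nxt x (cb t)) (cr t)).2].
  have [b1 [b2 [l1 [l2 [t1 [t2 [r1 [r2 [[A1 A2 A3 A4 A5] [[B1 B2 B3 B4]
    [[C1 C2 C3 C4] [[D1 D2 D3 D4] P]]]]]]]]]]]] := lift_tile t (svalP x).
  have Eb : h x (cb t) = (b1, b2) by exact: h_uniq.
  have El : h x (cl t) = (l1, l2) by exact: h_uniq.
  have Et : h (nxt x (cl t)) (ct t) = (t1, t2) by apply: h_uniq; rewrite //= El.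
  have Er : h (nxt x (cb t)) (cr t) = (r1, r2) by apply: h_uniq; rewrite //= Eb.
  by split; [apply: S_inj; rewrite /= Et Er | rewrite Et Er Eb El].
(* The grid is built by climbing the left border and then following the bottom edges of each row. *)
pose X0 j := nat_rect (fun _ => S) (exist _ v vS) (fun j x => nxt x (cl (f 0%N j))) j.
pose X i j := nat_rect (fun _ => S) (X0 j) (fun i x => nxt x (cb (f i j))) i.
have [f_rgt f_top] : (forall i j : nat, cr (f i j) = cl (f i.+1 j)) /\
    (forall i j : nat, ct (f i j) = cb (f i j.+1)).
  split=> i j; have [E1 E2] := f_valid i j.
    by rewrite /cr E1; congr (cl (f _ _)); lia.
  by rewrite /ct E2; congr (cb (f _ _)); lia.
(* Vertical steps agree with the row-wise construction in every column, by closing one tile at a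
   time. *)
have Xup i j : X i j.+1 = nxt (X i j) (cl (f i j)).
  elim: i => [//|i IHi].
  rewrite -[LHS]/(nxt (X i j.+1) (cb (f i j.+1))) IHi -f_top -(tileP _ _).1.
  by rewrite f_rgt.
exists (fun i j => sval (X i j)), (fun i j => (h (X i j) (cb (f i j))).1),
  (fun i j => (h (X i j) (cb (f i j))).2), (fun i j => (h (X i j) (cl (f i j))).1),
  (fun i j => (h (X i j) (cl (f i j))).2).
split=> // i j.
have [s1 m1 s2 m2] := hP (X i j) (cb (f i j)).
have [s1' m1' s2' m2'] := hP (X i j) (cl (f i j)).
do !split=> //; first by rewrite Xup.
all: have [_ [Q1 Q2 Q3 Q4]] := tileP (X i j) (f i j).
- by rewrite Xup -f_top.
- by rewrite Xup -f_top.
- by rewrite -f_rgt.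
- by rewrite -f_rgt.
Qed.

(** Common core of both halves. [P] cuts out the relevant vertices, [sim] is equality of states and
    [L] equality of labels. Labels are constant along strips, so similar grid points in one column
    or row have similar successors, and finitely many states yield a periodic tiling. *)
Lemma no_finite_deterministic_states (v : Vx Z) (P : Vx Z -> Prop)
    (sim : Vx Z -> Vx Z -> Prop) (L : Ex Z -> Ex Z -> Prop) (l : list (Vx Z)) :
  aperiodic T -> mV p v = Star r -> P v ->
  (forall e, P (src e) -> P (tgt e)) ->
  (forall x y, sim x y -> sim y x) ->
  (forall x y z, sim x y -> sim y z -> sim x z) ->
  (forall e, P (src e) -> L e e) ->
  (forall e e', L e e' -> L e' e) ->
  (forall e1 e2 e3, L e1 e2 -> L e2 e3 -> L e1 e3) ->
  (forall e e', P (src e) -> parallel e e' -> L e e') ->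
  (forall e e', sim (src e) (src e') -> L e e' -> sim (tgt e) (tgt e')) ->
  (forall x y c c', sim x y -> mV p x = Mid r c -> mV p y = Mid r c' -> c = c') ->
  (forall x, P x -> exists y, List.In y l /\ sim x y) ->
  False.
Proof.
move=> [[f f_valid] aper] vS Pv Ptgt simC simT L0 LC LT Lpar Ldet simM fin.
have [X [h1 [h2 [v1 [v2 [X0 HX]]]]]] := lift_quadrant f_valid vS.
have PX i j : P (X i j).
  elim: i => [|i IHi]; last first.
    have [[s1 s2 <- _] _] := HX i j.
    by apply: (Ptgt); rewrite s2; apply: (Ptgt); rewrite s1.
  elim: j => [|j IHj]; first by rewrite X0.
  have [_ [[s1 s2 <- _] _]] := HX 0 j.
  by apply: (Ptgt); rewrite s2; apply: (Ptgt); rewrite s1.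
have Lpar2 e e' : P (src e) -> (exists2 g, parallel e g & parallel g e') -> L e e'.
  move=> Pe [g eg ge']; apply: (LT _ g); apply: Lpar => //.
  by case: eg => a [b [[Ea _ -> _ _] _]]; apply: Ptgt; rewrite Ea.
have Ph1 i j : P (src (h1 i j)) by have [[-> _ _ _] _] := HX i j.
have Ph2 i j : P (src (h2 i j)) by have [[_ -> _ _] _] := HX i j; apply: Ptgt.
have Pv1 i j : P (src (v1 i j)) by have [_ [[-> _ _ _] _]] := HX i j.
have Pv2 i j : P (src (v2 i j)) by have [_ [[_ -> _ _] _]] := HX i j; apply: Ptgt.
have strip (e : nat -> Ex Z) : (forall k, P (src (e k))) ->
    (forall k, L (e k) (e k.+1)) -> forall k k', L (e k) (e k').
  move=> Pe Le k k'; suff to0 m : L (e 0) (e m) by apply: LT (LC _ _ (to0 k)) (to0 k').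
  by elim: m => [|m IHm]; [exact: L0 | exact: LT (Le m)].
have Lh1 i j j' : L (h1 i j) (h1 i j').
  by apply: strip => // k; apply: Lpar2 => //; have [_ [_ []]] := HX i k.
have Lh2 i j j' : L (h2 i j) (h2 i j').
  by apply: strip => // k; apply: Lpar2 => //; have [_ [_ []]] := HX i k.
have Lv1 i i' j : L (v1 i j) (v1 i' j).
  by apply: (strip (v1^~ j)) => // k; apply: Lpar2 => //; have [_ [_ []]] := HX k j.
have Lv2 i i' j : L (v2 i j) (v2 i' j).
  by apply: (strip (v2^~ j)) => // k; apply: Lpar2 => //; have [_ [_ []]] := HX k j.
(* A tile side is two half-edges; [simM] reads its color at the midpoint between them. *)
have two_steps x y e1 e2 g1 g2 c c' : sim x y -> src e1 = x -> src g1 = y ->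
    src e2 = tgt e1 -> src g2 = tgt g1 -> mE p e1 = Half r c false ->
    mE p g1 = Half r c' false -> L e1 g1 -> L e2 g2 ->
    c = c' /\ sim (tgt e2) (tgt g2).
  move=> sxy se1 sg1 se2 sg2 me mg L1 L2.
  have s1 : sim (tgt e1) (tgt g1) by apply: Ldet => //; rewrite se1 sg1.
  split; first by apply: simM s1 _ _; rewrite cov_tgt ?me ?mg.
  by apply: Ldet => //; rewrite se2 sg2.
apply: aper; apply: (periodic_of_finite_states (X := X) (l := l) f_valid simC simT).
- by move=> i j; exact: fin.
- move=> i j j' sX; have [[s1 s2 <- m] _] := HX i j.
  have [[s1' s2' <- m'] _] := HX i j'.
  by have [[]] := two_steps _ _ _ _ _ _ _ _ sX s1 s1' s2 s2' m m' (Lh1 _ _ _) (Lh2 _ _ _).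
- move=> i i' j sX; have [_ [[s1 s2 <- m] _]] := HX i j.
  have [_ [[s1' s2' <- m'] _]] := HX i' j.
  by have [[]] := two_steps _ _ _ _ _ _ _ _ sX s1 s1' s2 s2' m m' (Lv1 _ _ _) (Lv2 _ _ _).
Qed.

End Covering.

(** * Finite special covers *)

Lemma special_edge_deterministic (X : sqcx) (d : Ex X -> bool) (e1 e2 : Ex X) :
  (forall (s : Sx X) k, (side s k).2 = ~~ (side s k.+2).2) ->
  consistent_dual d -> ~ self_intersects X -> ~ directly_self_osculates d ->
  src e1 = src e2 -> hyp_eq e1 e2 -> e1 = e2.
Proof.
move=> flags dP no_int no_osc Esrc E12; apply: NNPP => neq12.
(* The given orientation is itself parallel on squares, so [d] agrees with it or reverses it
   uniformly along a hyperplane. A common source is then a common dual start or a common dual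
   end. *)
have Ed : d e1 = d e2.
  elim: E12 => {e1 e2 Esrc neq12} [_ _ [s [k [<- <-]]]|//|x y _ -> //|x y z _ -> _ //].
  by have := dP s k; rewrite (flags s k); do 2!case: (d _); case: (side s k.+2).2.
have [s [k [[E1 E2]|[E2 E1]]]] : in_common_square e1 e2.
- apply: NNPP => no_sq; apply: no_osc; exists e1, e2; do 3!split=> //.
  by rewrite /dstart /dend Ed; case: (d e2); [left | right].
- by apply: no_int; exists s, k; rewrite E1 E2.
- by apply: no_int; exists s, k; rewrite E1 E2; apply: rst_sym.
Qed.

(** Coverings preserve traversal flags, so it is enough to inspect the four quadrants of W(T). *)
Lemma WT_side_flags (T : tileset) (r : color T -> nat) (Z : sqcx)
    (p : cxmap Z (WT r)) (s : Sx Z) (k : nat) :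
  is_covering p -> (side s k).2 = ~~ (side s k.+2).2.
Proof.
move=> p_cov.
have E i : (bd s i).2 = (Wbd r (mS p s) i).2 by rewrite (cov_bd p_cov).
rewrite [side s k]side_mod4 [side s k.+2]side_mod4 -(addn2 k) -modnDml !side_ord4 !E.
have := ltn_pmod k (isT : 0 < 4); case: (k %% 4) => [|[|[|[|//]]]] _;
by case: (mS p s) => t [[|[|[|[|//]]]] ?].
Qed.

Lemma WT_not_virtually_special (T : tileset) (r : color T -> nat) :
  aperiodic T -> ~ virtually_special (WT r).
Proof.
move=> aper [Y [p [Y_wf [[[l l_full] _] [p_cov [d [dP [no_int [no_osc _]]]]]]]]].
have [v vS] : exists v, mV p v = Star r by case: p_cov => _ [_ [_ [H _]]]; apply: H.
(* States are the vertices of the finite cover and labels are its hyperplanes. *)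
apply: (no_finite_deterministic_states (P := fun=> True) (sim := eq)
  (L := @hyp_eq Y) (l := l) p_cov Y_wf aper vS) => //.
- by move=> x y z -> .
- by move=> e _; apply: rst_refl.
- by move=> e e'; apply: rst_sym.
- by move=> e1 e2 e3; apply: rst_trans.
- by move=> e e' _ [a [b [_ opp]]]; apply: rst_step.
- move=> e e' Esrc Ehyp; congr (tgt _).
  by apply: (special_edge_deterministic (d := d)) => // s k; apply: WT_side_flags p_cov.
- by move=> x y c c' ->; congruence.
- by move=> x _; exists x.
Qed.

(** * Principal filters and directed paths *)

Section FilterIso.
Variables (D A : Type) (le : D -> D -> Prop) (lam : D -> D -> A).
Hypothesis le_refl : forall x, le x x.
Hypothesis le_trans : forall x y z, le x y -> le y z -> le x z.
Hypothesis le_anti : forall x y, le x y -> le y x -> x = y.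

(** Anything between two elements of a principal filter lies in that filter, so an intermediate
    element can be pulled back by [psi]. Labels are left out so that the inverse isomorphism can be
    treated too. *)
Lemma hcov_transfer (x y : D) (phi psi : D -> D) (a a' : D) :
  (forall a, le x a -> le y (phi a) /\ psi (phi a) = a) ->
  (forall b, le y b -> le x (psi b) /\ phi (psi b) = b) ->
  (forall a a', le x a -> le x a' -> (le a a' <-> le (phi a) (phi a'))) ->
  le x a -> hcov le a a' -> hcov le (phi a) (phi a').
Proof.
move=> Hphi Hpsi mono xa [[aa' neq] nobetween].
have xa' : le x a' by exact: le_trans aa'.
split; first split; first exact: (mono a a' xa xa').1.
  by move=> /(congr1 psi); rewrite (Hphi a xa).2 (Hphi a' xa').2.
case=> z [[az neq_az] [za' neq_za']]; apply: nobetween; exists (psi z).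
have yz : le y z by apply: le_trans az; case: (Hphi a xa).
have [xz Ez] := Hpsi z yz.
split; split.
- by apply/(mono a _ xa xz); rewrite Ez.
- by move=> E; apply: neq_az; rewrite E Ez.
- by apply/(mono _ a' xz xa'); rewrite Ez.
- by move=> E; apply: neq_za'; rewrite -E Ez.
Qed.

Lemma filters_iso_sym x y : filters_iso le lam x y -> filters_iso le lam y x.
Proof.
case=> phi [psi [Hphi [Hpsi [mono lab]]]].
have mono' b b' : le y b -> le y b' -> (le b b' <-> le (psi b) (psi b')).
  move=> yb yb'; have [xb Eb] := Hpsi b yb; have [xb' Eb'] := Hpsi b' yb'.
  by have [] := mono _ _ xb xb'; rewrite Eb Eb'; split.
exists psi, phi; do 3!split=> //; move=> b b' yb yb' cov.
have [xb Eb] := Hpsi b yb; have [xb' Eb'] := Hpsi b' yb'.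
have cov' := hcov_transfer Hpsi Hphi mono' yb cov.
by have := lab _ _ xb xb' cov'; rewrite Eb Eb'.
Qed.

Lemma filters_iso_trans x y z :
  filters_iso le lam x y -> filters_iso le lam y z -> filters_iso le lam x z.
Proof.
case=> f [g [Hf [Hg [mono lab]]]] [f' [g' [Hf' [Hg' [mono' lab']]]]].
exists (f' \o f), (g \o g'); split; [|split; [|split]] => /=.
- move=> a xa; have [yfa Ea] := Hf a xa; have [zfa E] := Hf' _ yfa.
  by rewrite E.
- move=> b zb; have [yb Eb] := Hg' b zb; have [xb E] := Hg _ yb.
  by rewrite E.
- move=> a a' xa xa'; have [m1 m2] := mono _ _ xa xa'.
  have [n1 n2] := mono' _ _ (Hf a xa).1 (Hf a' xa').1.
  by split=> [/m1/n1|/n2/m2].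
- move=> a a' xa xa' cov; have cov' := hcov_transfer Hf Hg mono xa cov.
  by rewrite -(lab _ _ xa xa' cov) (lab' _ _ (Hf a xa).1 (Hf a' xa').1 cov').
Qed.

(** The isomorphism matches the least elements [x] and [y] by antisymmetry and restricts to the
    filter of [x1]. With distinct labels on out-edges, this makes successors of filter types
    deterministic. *)
Lemma filters_iso_cover x y x1 :
  filters_iso le lam x y -> hcov le x x1 ->
  exists y1, [/\ hcov le y y1, lam y y1 = lam x x1 & filters_iso le lam x1 y1].
Proof.
case=> f [g [Hf [Hg [mono lab]]]] cov; have xx1 := cov.1.1.
have Exy : f x = y.
  apply: le_anti; last exact: (Hf x (le_refl x)).1.
  have [xgy E] := Hg y (le_refl y); rewrite -[X in le _ X]E.
  exact: (mono _ _ (le_refl x) xgy).1.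
exists (f x1); rewrite -Exy; split.
- exact: (hcov_transfer Hf Hg mono).
- exact: lab.
exists f, g.
have up a : le x1 a -> le x a by apply: le_trans.
split; [|split; [|split]].
- move=> a /[dup] x1a /up xa; split; last exact: (Hf a xa).2.
  exact: (mono _ _ xx1 xa).1.
- move=> b fb; have yb : le y b by apply: le_trans fb; exact: (Hf x1 xx1).1.
  have [xb Eb] := Hg b yb; split=> //.
  by apply/(mono _ _ xx1 xb); rewrite Eb.
- by move=> a a' /up xa /up xa'; apply: mono.
- by move=> a a' /up xa /up xa'; apply: lab.
Qed.

(** Every maximal chain of covers from [x] has exactly [n] steps: an isomorphism invariant of
    filters that recognizes tips and their remaining length. *)
Fixpoint uniform_height (n : nat) (x : D) : Prop :=
  if n is m.+1 then
    (exists y, hcov le x y) /\ forall y, hcov le x y -> uniform_height m y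
  else ~ exists y, hcov le x y.

Lemma uniform_height_iso n x y :
  filters_iso le lam x y -> uniform_height n x -> uniform_height n y.
Proof.
elim: n x y => [|n IHn] x y xy /=.
  move=> no_cov [y1 cov]; apply: no_cov.
  by have [x1 [cov1 _ _]] := filters_iso_cover (filters_iso_sym xy) cov; exists x1.
case=> [[x1 cov] all]; split.
  by have [y1 [cov1 _ _]] := filters_iso_cover xy cov; exists y1.
move=> y1 cov1.
have [x2 [cov2 _ iso]] := filters_iso_cover (filters_iso_sym xy) cov1.
exact: IHn (filters_iso_sym iso) (all _ cov2).
Qed.

Lemma uniform_height_unique n m x :
  uniform_height n x -> uniform_height m x -> n = m.
Proof.
elim: n m x => [|n IHn] [|m] x //=; [by move=> ? [] | by case |].
by move=> [[y xy] /(_ y xy) hn] [_ /(_ y xy) hm]; rewrite (IHn _ _ hn hm).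
Qed.

End FilterIso.

(** * Signed length of paths and the covers of the event domain *)

Section Paths.
Variable X : sqcx.
Implicit Types (u v w : Vx X) (p q : list (Ex X * bool)).

Lemma path_from_cat v p q :
  path_from v (p ++ q) <-> path_from v p /\ path_from (path_end v p) q.
Proof. by elim: p v => [|eb p IHp] v /=; [tauto | rewrite IHp; tauto]. Qed.

Lemma path_end_cat v p q : path_end v (p ++ q) = path_end (path_end v p) q.
Proof. by elim: p v => //=. Qed.

Lemma dreach_refl v : dreach v v.
Proof. by exists nil. Qed.

Lemma dreach_edge (e : Ex X) : dreach (src e) (tgt e).
Proof. by exists [:: (e, true)]; do !split=> //; apply: List.Forall_cons. Qed.

Lemma dreach_trans u v w : dreach u v -> dreach v w -> dreach u w.
Proof.
move=> [p [pu [pf <-]]] [q [qu [qf <-]]]; exists (p ++ q).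
split; first exact/path_from_cat.
by split; [apply/List.Forall_app | exact: path_end_cat].
Qed.

Definition signed_length p : int := (\sum_(eb <- p) if eb.2 then 1 else -1)%R.

Lemma signed_length_cat p q :
  signed_length (p ++ q) = (signed_length p + signed_length q)%R.
Proof. exact: big_cat. Qed.

Lemma signed_length_directed p :
  List.Forall (fun eb => eb.2 = true) p -> signed_length p = Posz (size p).
Proof.
rewrite /signed_length.
elim=> [|eb q Eb _ IH]; first by rewrite big_nil.
by rewrite big_cons Eb IH /=; lia.
Qed.

Hypothesis flags : forall (s : Sx X) k, (side s k).2 = ~~ (side s k.+2).2.

(** A backtrack contributes 0, and so does the boundary of a square, since opposite sides are
    traversed with opposite signs. *)
Lemma signed_length_homotopic p q :
  homotopic p q -> signed_length p = signed_length q.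
Proof.
elim=> {p q} [_ _ []|//|//|p q w _ -> _ -> //].
- move=> p q e b; rewrite !signed_length_cat /signed_length !big_cons /=.
  by case: b => /=; lia.
- move=> p q s k; rewrite !signed_length_cat /signed_length !big_cons big_nil.
  by rewrite (flags s k) (flags s k.+1); do 2!case: (_.2); rewrite /=; lia.
- move=> p q s k; rewrite !signed_length_cat /signed_length /rev_path /=.
  rewrite !big_cons big_nil /=.
  by rewrite (flags s k) (flags s k.+1); do 2!case: (_.2); rewrite /=; lia.
Qed.

Hypothesis X_sc : simply_connected X.

Lemma signed_length_closed v p :
  path_from v p -> path_end v p = v -> signed_length p = 0%R.
Proof.
move=> pv pe; rewrite (signed_length_homotopic (X_sc.2 v p pv pe)).
exact: big_nil.
Qed.

(** The two directed paths form a loop whose signed length is its number of edges, so both are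
    empty. *)
Lemma dreach_anti u v : dreach u v -> dreach v u -> u = v.
Proof.
move=> [p [pu [pf pe]]] [q [qu [qf qe]]].
have : signed_length (p ++ q) = 0%R.
  apply: (@signed_length_closed u); first by rewrite path_from_cat pe.
  by rewrite path_end_cat pe.
rewrite signed_length_cat !signed_length_directed // => /eqP.
by case: p pe {pu pf} => [|eb p] //= _ ; lia.
Qed.

Lemma src_neq_tgt (e : Ex X) : src e <> tgt e.
Proof.
move=> E; have := @signed_length_closed (src e) [:: (e, true)] (conj erefl I) (esym E).
by rewrite /signed_length big_cons big_nil.
Qed.

(** Going through [z] and back along [e] is a loop, so the two directed paths have total length 1
    and one of them is empty. *)
Lemma dreach_edge_between (e : Ex X) z :
  dreach (src e) z -> dreach z (tgt e) -> src e = z \/ z = tgt e.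
Proof.
move=> [p [pu [pf pe]]] [q [qu [qf qe]]].
have : signed_length (p ++ q ++ [:: (e, false)]) = 0%R.
  apply: (@signed_length_closed (src e)); last by rewrite !path_end_cat.
  by do !rewrite path_from_cat; rewrite pe qe.
rewrite !signed_length_cat (signed_length_directed pf) (signed_length_directed qf).
rewrite /signed_length big_cons big_nil /=.
case: p pe {pu pf} => [|? p] /= pe; first by left.
case: q qe {qu qf} => [|? q] /= qe; first by right.
by lia.
Qed.

Variable v : Vx X.

Lemma evdom_inj (x y : evdom v) : sval x = sval y -> x = y.
Proof.
by case: x y => x px [y py] /= E; subst y; rewrite (proof_irrelevance _ px py).
Qed.

Lemma evle_anti (x y : evdom v) : evle x y -> evle y x -> x = y.
Proof. by move=> xy yx; apply: evdom_inj; apply: dreach_anti. Qed.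

Lemma hcov_evleP (x y : evdom v) :
  hcov (@evle X v) x y <-> exists e, src e = sval x /\ tgt e = sval y.
Proof.
split=> [[[[p [pu [pf pe]]] neq] nobetween]|[e [Ex Ey]]].
  case: p pu pf pe => [|[e b] p] /= pu pf pe; first by case: neq; apply: evdom_inj.
  move: pu pe; have [/= -> pf'] := proj1 (List.Forall_cons_iff _ _ _) pf.
  rewrite /ostart /oend /= => -[Es pp] pe; exists e; split=> //.
  (* Otherwise the end of the first edge of the path lies strictly between [x] and [y]. *)
  apply: NNPP => neq_t; apply: nobetween.
  have vt : dreach v (tgt e).
    by apply: dreach_trans (dreach_edge e); rewrite Es; exact: (svalP x).
  exists (exist _ _ vt); split; split.
  - by rewrite /evle /= -Es; exact: dreach_edge.
  - by move=> /(congr1 sval) /= E; apply: (@src_neq_tgt e); rewrite Es E.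
  - by exists p.
  - by move=> /(congr1 sval).
split.
  split; first by rewrite /evle -Ex -Ey; exact: dreach_edge.
  by move=> E; apply: (@src_neq_tgt e); rewrite Ex Ey E.
case=> z [[xz neq_xz] [zy neq_zy]].
have [|||E] := @dreach_edge_between e (sval z); rewrite ?Ex ?Ey //.
- by move=> /evdom_inj.
- by apply: neq_zy; apply: evdom_inj; rewrite -Ey.
Qed.

End Paths.

(** * The universal cover *)

Section Tips.
Variables (T : tileset) (r : color T -> nat).

(** The number of tip edges still ahead; [None] off the tips and at midpoints. *)
Definition tip_height (x : WV r) : option nat :=
  if x is TipV c i then Some (r c - i.+1) else None.

Lemma tip_height_step (e : WE r) n : tip_height (Wsrc e) = Some n ->
  exists2 m, n = m.+1 & tip_height (Wtgt e) = Some m.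
Proof.
case: e => [c []|t|t|t|t|c [[|j] lt_j]] //= [<-].
by exists (r c - j.+2) => //; lia.
Qed.

Lemma tip_height_succ_edge (x : WV r) n : tip_height x = Some n.+1 ->
  exists e : WE r, Wsrc e = x.
Proof.
case: x => // c [i lt_i] /= [E]; have lt_Si : i.+1 < r c by lia.
by exists (TipE (Ordinal lt_Si)) => /=; congr TipV; apply: val_inj.
Qed.

(** Off the tips one can continue forever without entering a tip; [c] supplies the edge to follow at
    [Star]. *)
Lemma no_tip_edge (c : color T) (x : WV r) : tip_height x = None ->
  exists e : WE r, Wsrc e = x /\ tip_height (Wtgt e) = None.
Proof.
case: x => [|c'|t|//] _.
- by exists (Half r c false).
- by exists (Half r c' true).
- by exists (InR r t).
Qed.

Lemma mid_tip_edge c : 0 < r c ->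
  exists e : WE r, Wsrc e = Mid r c /\ tip_height (Wtgt e) = Some (r c).-1.
Proof.
by move=> r_gt0; exists (TipE (Ordinal r_gt0)); rewrite /= subn1.
Qed.

Lemma mid_edge_height (e : WE r) c : Wsrc e = Mid r c ->
  tip_height (Wtgt e) = None \/ tip_height (Wtgt e) = Some (r c).-1.
Proof.
by case: e => [c' []|t|t|t|t|c' [[|j] lt_j]] //=; auto => -[->]; right; rewrite subn1.
Qed.

End Tips.

Section UniversalCover.
Variables (T : tileset) (r : color T -> nat) (U : sqcx) (p : cxmap U (WT r)).
Hypotheses (p_cov : is_covering p) (U_sc : simply_connected U).
Variable v : Vx U.
Let flags (s : Sx U) k : (side s k).2 = ~~ (side s k.+2).2 :=
  WT_side_flags s k p_cov.

Definition evdom_tgt (x : evdom v) (e : Ex U) (Ex : src e = sval x) : evdom v :=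
  exist _ (tgt e) (dreach_trans (eq_ind_r _ (svalP x) Ex) (dreach_edge e)).

Lemma hcov_evdom_tgt (x : evdom v) (e : Ex U) (Ex : src e = sval x) :
  hcov (@evle U v) x (evdom_tgt Ex).
Proof. by apply/(hcov_evleP flags U_sc); exists e. Qed.

Lemma hcov_lift_edge (x : evdom v) (e' : WE r) : Wsrc e' = mV p (sval x) ->
  exists y, hcov (@evle U v) x y /\ mV p (sval y) = Wtgt e'.
Proof.
move=> /(cov_edge_lift p_cov) [e [Ee <-]].
by exists (evdom_tgt Ee); split; [exact: hcov_evdom_tgt | rewrite -(cov_tgt p_cov)].
Qed.

Lemma hcov_proj_edge (x y : evdom v) : hcov (@evle U v) x y ->
  exists e' : WE r, Wsrc e' = mV p (sval x) /\ Wtgt e' = mV p (sval y).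
Proof.
move=> /(hcov_evleP flags U_sc) [e [<- <-]].
by exists (mE p e); rewrite (cov_src p_cov) (cov_tgt p_cov).
Qed.

Lemma uniform_height_tip n (x : evdom v) :
  tip_height (mV p (sval x)) = Some n -> uniform_height (@evle U v) n x.
Proof.
elim: n x => [|n IHn] x hx /=.
  case=> y /hcov_proj_edge [e' [Es Et]]; rewrite -Es in hx.
  by have [] := tip_height_step hx.
split.
  have [e' Es] := tip_height_succ_edge hx.
  by have [y [xy _]] := hcov_lift_edge Es; exists y.
move=> y /hcov_proj_edge [e' [Es Et]]; apply: IHn.
by rewrite -Es in hx; have [m [->] <-] := tip_height_step hx; rewrite -Et.
Qed.

(** Directed paths avoiding the tips lift to the cover with arbitrary length. *)
Lemma no_uniform_height (c : color T) n (x : evdom v) :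
  tip_height (mV p (sval x)) = None -> ~ uniform_height (@evle U v) n x.
Proof.
elim: n x => [|n IHn] x /(no_tip_edge c) [e' [Es Et]];
  have [y [xy Ey]] := hcov_lift_edge Es => /=.
  by apply; exists y.
by case=> _ /(_ y xy); apply: IHn; rewrite Ey.
Qed.

(* The color of a midpoint is read off its principal filter: the only covers
   with a uniform height are the first vertices of its tip. *)
Lemma filters_iso_mid (A : Type) (lam : evdom v -> evdom v -> A)
    (x y : evdom v) c c' :
  injective r -> (forall c, 0 < r c) ->
  filters_iso (@evle U v) lam x y ->
  mV p (sval x) = Mid r c -> mV p (sval y) = Mid r c' -> c = c'.
Proof.
move=> r_inj r_gt0 iso Ex Ey; apply: r_inj.
have [e' [Es Et]] := mid_tip_edge (r_gt0 c).
have [|x1 [xx1 Ex1]] := @hcov_lift_edge x e'; first by rewrite Ex.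
have hx1 : uniform_height (@evle U v) (r c).-1 x1.
  by apply: uniform_height_tip; rewrite Ex1.
have le_refl z : @evle U v z z by exact: dreach_refl.
have le_trans : forall z1 z2 z3, @evle U v z1 z2 -> evle z2 z3 -> evle z1 z3.
  by move=> z1 z2 z3; exact: dreach_trans.
have le_anti := @evle_anti _ flags U_sc v.
have [y1 [yy1 _ iso1]] := filters_iso_cover le_refl le_trans le_anti iso xx1.
have hy1 := uniform_height_iso le_refl le_trans le_anti iso1 hx1.
have [g [Gs Gt]] := hcov_proj_edge yy1.
rewrite Ey in Gs; have [] := mid_edge_height Gs; rewrite Gt => ht.
  by case: (no_uniform_height c ht hy1).
have := uniform_height_unique hy1 (uniform_height_tip ht).
by have := r_gt0 c; have := r_gt0 c'; lia.
Qed.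

Lemma no_regular_nice_labeling :
  sc_wf U -> injective r -> (forall c, 0 < r c) -> aperiodic T ->
  mV p v = Star r -> ~ admits_regular_nice_labeling (@evle U v).
Proof.
move=> U_wf r_inj r_gt0 aper vS [n [lam [[det square] [l reg]]]].
pose le := @evle U v.
have le_refl z : le z z by exact: dreach_refl.
have le_trans z1 z2 z3 : le z1 z2 -> le z2 z3 -> le z1 z3 by exact: dreach_trans.
have le_anti : forall x y, le x y -> le y x -> x = y := @evle_anti _ flags U_sc v.
have covP (x y : evdom v) : hcov le x y <-> exists e, src e = sval x /\ tgt e = sval y.
  exact: (hcov_evleP flags U_sc).
(* The core lemma speaks of vertices and edges of [U], while filters and labels live on [evdom v];
   the representatives are unique by [evdom_inj]. *)
pose sim a b := exists x y : evdom v,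
  [/\ sval x = a, sval y = b & filters_iso le lam x y].
pose L e e' := exists x y x' y' : evdom v,
  [/\ sval x = src e, sval y = tgt e, sval x' = src e', sval y' = tgt e' &
      lam x y = lam x' y'].
have lift e : dreach v (src e) ->
    exists x y : evdom v, sval x = src e /\ sval y = tgt e.
  move=> ve; exists (exist _ _ ve), (exist _ _ (dreach_trans ve (dreach_edge e))).
  by [].
apply: (no_finite_deterministic_states (P := dreach v) (sim := sim) (L := L)
  (l := List.map (fun y : evdom v => sval y) l) p_cov U_wf aper vS).
- exact: dreach_refl.
- by move=> e ve; exact: dreach_trans (dreach_edge e).
- by move=> a b [x [y [Ea Eb iso]]]; exists y, x; split=> //; exact: filters_iso_sym.
- move=> a b c [x [y [Ea Eb iso]]] [y' [z [Eb' Ec iso']]]; exists x, z; split=> //.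
  have Ey : y' = y by apply: evdom_inj; congruence.
  by rewrite Ey in iso'; apply: filters_iso_trans iso iso'.
- by move=> e /lift [x [y [Ex Ey]]]; exists x, y, x, y.
- move=> e e' [x [y [x' [y' [? ? ? ? E]]]]]; exists x', y', x, y.
  by rewrite E.
- move=> e1 e2 e3 [x [y [x' [y' [A1 A2 A3 A4 E]]]]] [x2 [y2 [x3 [y3 [B1 B2 B3 B4 F]]]]].
  exists x, y, x3, y3; split=> //; rewrite E -F.
  by congr (lam _ _); apply: evdom_inj; congruence.
- move=> e e' /[dup] ve /lift [x [y1 [Ex Ey1]]] [a [b [[Ea Eb Es Et neq] _]]].
  have [|x' [y2 [Ex' Ey2]]] := lift a; first by rewrite Ea.
  have [|y2' [z [Ey2' Ez]]] := lift e'.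
    by rewrite Es -Ey2; exact: (svalP y2).
  have E2 : y2' = y2 by apply: evdom_inj; congruence.
  subst y2'.
  have x_y1 : hcov le x y1 by apply/covP; exists e.
  have x_y2 : hcov le x y2 by apply/covP; exists a; split; congruence.
  have y1_z : hcov le y1 z by apply/covP; exists b; split; congruence.
  have y2_z : hcov le y2 z by apply/covP; exists e'.
  have neq12 : y1 <> y2 by move=> E; apply: neq; rewrite -Ey1 E Ey2'.
  have [lam_eq _] := square _ _ _ _ x_y1 x_y2 y1_z y2_z neq12.
  by exists x, y1, y2, z.
- move=> e e' [x [x' [Ex Ex' iso]]] [x2 [y [x2' [y' [E2 Ey E2' Ey' Elam]]]]].
  have E : x2 = x by apply: evdom_inj; congruence.
  have E' : x2' = x' by apply: evdom_inj; congruence.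
  subst x2 x2'.
  have xy : hcov le x y by apply/covP; exists e.
  have xy' : hcov le x' y' by apply/covP; exists e'.
  (* The isomorphism yields a cover of [x'] with the label of [e]; distinctness of labels identifies
     it with the end of [e']. *)
  have [y2 [xy2 Elam2 iso2]] := filters_iso_cover le_refl le_trans le_anti iso xy.
  have Ey2 : y2 = y'.
    by apply: NNPP => neq; apply: (det x' y2 y') => //; rewrite Elam2 Elam.
  by exists y, y'; rewrite -{2}Ey2.
- move=> a b c c' [x [y [<- <- iso]]] Mx My.
  exact: (filters_iso_mid r_inj r_gt0 iso Mx My).
- move=> a va; have [y [y_l iso]] := reg (exist _ a va).
  exists (sval y); split; first exact: List.in_map.
  by exists (exist _ a va), y.
Qed.

End UniversalCover.

Theorem theorem7p2 (T : tileset) (r : color T -> nat) :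
  tileset_wf T ->
  injective r -> (forall c, 0 < r c) ->
  four_way_det T -> aperiodic T ->
  ~ virtually_special (WT r) /\
  (forall (U : sqcx) (p : cxmap U (WT r)),
      sc_wf U -> is_covering p -> simply_connected U ->
      forall v : Vx U, mV p v = Star r ->
      ~ admits_regular_nice_labeling (@evle U v)).
Proof.
move=> _ r_inj r_gt0 _ aper; split; first exact: WT_not_virtually_special.
move=> U p U_wf p_cov U_sc v vS.
exact: (no_regular_nice_labeling p_cov).
Qed.
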